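(* Let $A$ have at least three elements and $I$ an arbitrary (possibly infinite) set. Suppose $C\colon\mathrm{PPO}_A^I\to\mathrm{PPO}_A$ is a principal voting system satisfying unanimity and independence of irrelevant alternatives that maps $\mathrm{LPO}_A^I$ into $\mathrm{LPO}_A$. Then $C=\mathrm{Lex}_{(J,\le)}$ for some subset $J\subseteq I$ equipped with a well-ordering $\le$, and the pair $(J,\le)$ is uniquely determined by $C$. Conversely, every such pair $(J,\le)$ is realized in this way, giving a bijection between these voting systems and well-ordered sets $(J,\le)$ with $J\subseteq I$. Moreover, $C$ satisfies strong unanimity if and only if $J=I$; hence principal voting systems satisfying unanimity and IIA that map $\mathrm{LPO}_A^I$ to $\mathrm{LPO}_A$ and satisfy strong unanimity are in bijective correspondence with well-orderings of $I$.
   Context: $\mathrm{PPO}_A$ is the set of reflexive transitive relations on $A$, $\mathrm{LPO}_A$ the complete ones. For a profile $P=(P_i)_{i\in I}$: $a\succsim b$ means $(a,b)\in C(P)$, $a\succsim_i b$ means $(a,b)\in P_i$; $\succ,\succ_i$ strict parts; $a\sim_i b$ means both directions; for $L\subseteq I$ subscripts $L$ mean ''for all members of $L$''. Unanimity: $a\succsim_I b\Rightarrow a\succsim b$. Strong unanimity: unanimity, and if $a\succsim_I b$ and $a\succ_i b$ for some $i$ then $a\succ b$. IIA: for profiles $P,P'$ with outcomes $\succsim,\succsim'$, if $\{i:a\succsim_i b\}=\{i:a\succsim'_i b\}$ and $\{i:b\succsim_i a\}=\{i:b\succsim'_i a\}$ then $a\succsim b\iff a\succsim'b$. For $N\subseteq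 I$, $L\subseteq I\setminus N$ is decisive relative to $N$ if for every profile and all $a,b$, $a\sim_N b$ and $a\succ_L b$ imply $a\succsim b$. $C$ is principal if for each $N\subseteq I$ there is a minimal subset of $I\setminus N$ decisive relative to $N$. For $J\subseteq I$ with a well-ordering $\le$, $\mathrm{Lex}_{(J,\le)}$ is defined by: $a\sim b$ iff $a\sim_J b$; otherwise let $j\in J$ be the $\le$-smallest element with not $a\sim_j b$, and set $a\succsim b$ iff $a\succsim_j b$, and $b\succsim a$ iff $b\succsim_j a$. *)

(* Defs.v *)
From Corelib Require Relation_Definitions.
From mathcomp Require Import all_boot.
From mathcomp Require Import boolp classical_sets functions.

Set Implicit Arguments.
Unset Strict Implicit.
Unset Printing Implicit Defensive.

Local Open Scope classical_set_scope.

Record ppo (A : Type) := PPO {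
  ppo_rel :> A -> A -> Prop;
  ppo_preorder : Relation_Definitions.preorder A ppo_rel
}.

Definition lpo (A : Type) : set (ppo A) := [set R | forall a b, R a b \/ R b a].
Arguments lpo : clear implicits.

Definition strict (A : Type) (R : ppo A) (a b : A) : Prop := R a b /\ ~ R b a.

Definition indiff (A : Type) (R : ppo A) (a b : A) : Prop := R a b /\ R b a.

Definition profile (I A : Type) : Type := I -> ppo A.

Definition voting_system (I A : Type) : Type := profile I A -> ppo A.

Section VotingSystems.
Variables (I A : Type).
Implicit Types (C : voting_system I A) (P : profile I A) (N L : set I).

Definition unanimity C : Prop :=
  forall P a b, (forall i, P i a b) -> C P a b.

Definition strong_unanimity C : Prop :=
  unanimity C /\
  forall P a b, (forall i, P i a b) -> (exists i, strict (P i) a b) ->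
    strict (C P) a b.

Definition iia C : Prop :=
  forall P P' a b,
    [set i | P i a b] = [set i | P' i a b] ->
    [set i | P i b a] = [set i | P' i b a] ->
    (C P a b <-> C P' a b).

Definition decisive C N L : Prop :=
  L `<=` ~` N /\
  forall P a b,
    (forall i, N i -> indiff (P i) a b) ->
    (forall i, L i -> strict (P i) a b) ->
    C P a b.

Definition minimal_decisive C N L : Prop :=
  decisive C N L /\ forall L', L' `<=` L -> decisive C N L' -> L' = L.

Definition principal C : Prop := forall N, exists L, minimal_decisive C N L.

Definition preserves_lpo C : Prop :=
  forall P, (forall i, lpo A (P i)) -> lpo A (C P).

Definition principal_arrow C : Prop :=
  [/\ principal C, unanimity C, iia C & preserves_lpo C].

End VotingSystems.

Definition least_in (I : Type) (le : I -> I -> Prop) (B : set I) (m : I) : Prop :=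
  B m /\ forall i, B i -> le m i.

(* The order is a subset of J x J (field [wo_sub]), so that two well-orderings
   of J are equal as records exactly when they are the same ordering. *)
Record well_ordering (I : Type) (J : set I) := WellOrdering {
  wo_le :> I -> I -> Prop;
  wo_sub : forall i j, wo_le i j -> J i /\ J j;
  wo_refl : forall i, J i -> wo_le i i;
  wo_anti : forall i j, wo_le i j -> wo_le j i -> i = j;
  wo_trans : forall i j k, wo_le i j -> wo_le j k -> wo_le i k;
  wo_total : total_on J wo_le;
  wo_least : forall B, B `<=` J -> B !=set0 -> exists m, least_in wo_le B m
}.

Definition wo_subset (I : Type) : Type := {J : set I & well_ordering J}.

Section Lex.
Variables (I A : Type) (J : set I) (le : well_ordering J).
Implicit Types P : profile I A.

Definition lex_rel P (a b : A) : Prop :=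
  (forall i, J i -> indiff (P i) a b) \/
  (exists j, least_in le [set i | J i /\ ~ indiff (P i) a b] j /\ P j a b).

Lemma lex_rel_at P a b m : J m ->
  (forall i, J i -> ~ le m i -> indiff (P i) a b) -> lex_rel P a b -> P m a b.
Proof.
move=> Jm below [ab|[j [[[Jj nab] leastj] ab]]]; first by case: (ab m Jm).
have [[]//|nabm] := pselect (indiff (P m) a b).
have jm : le j m by exact: leastj.
have [mj|nmj] := pselect (le m j); first by rewrite (wo_anti mj jm).
by case: nab; exact: below.
Qed.

Lemma lex_rel_preorder P : Relation_Definitions.preorder A (lex_rel P).
Proof.
have Rf i := Relation_Definitions.preord_refl _ _ (ppo_preorder (P i)).
have Tr i := Relation_Definitions.preord_trans _ _ (ppo_preorder (P i)).
split; first by move=> a; left=> i _; split; exact: Rf.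
move=> a b c ab bc.
pose S := [set i | J i /\ ~ (indiff (P i) a b /\ indiff (P i) b c)].
have indiff_ac i : indiff (P i) a b /\ indiff (P i) b c -> indiff (P i) a c.
  by move=> [[h1 h2] [h3 h4]]; split; [exact: (Tr i a b c)|exact: (Tr i c b a)].
have [S0|/existsNP[i0 /not_implyP[Ji0 Si0]]] := pselect
    (forall i, J i -> indiff (P i) a b /\ indiff (P i) b c).
  by left=> i Ji; apply: indiff_ac; exact: S0.
have [m [[Jm Sm] leastm]] : exists m, least_in le S m.
  by apply: wo_least => [i []//|]; exists i0.
have below i : J i -> ~ le m i -> indiff (P i) a b /\ indiff (P i) b c.
  by move=> Ji nmi; apply: contrapT => Si; apply: nmi; apply: leastm.
have abm : P m a b by apply: lex_rel_at ab => // i Ji /(below _ Ji)[].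
have bcm : P m b c by apply: lex_rel_at bc => // i Ji /(below _ Ji)[].
right; exists m; split; last exact: (Tr m a b c).
split=> [|i [Ji nac]].
  split=> // -[_ ca]; apply: Sm; split; split=> //.
  - exact: (Tr m b c a).
  - exact: (Tr m c a b).
by apply: contrapT => /(below _ Ji) /indiff_ac.
Qed.

Definition lex : voting_system I A := fun P => PPO (lex_rel_preorder P).

End Lex.

Arguments lex {I} A {J} le.

(* Main.v *)
Require Import Defs.
From mathcomp Require Import all_boot.
From mathcomp Require Import boolp classical_sets functions.

Set Implicit Arguments.
Unset Strict Implicit.
Unset Printing Implicit Defensive.

Local Open Scope classical_set_scope.

(* Arrow's field-expansion argument, relative to a set N of indifferent voters,
   shows that a minimal decisive set is empty or a singleton {j}. In the latter
   case j "leads" N: as soon as j is not indifferent, the outcome copies j, even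
   when j finds the alternatives incomparable. A leader of N also leads every
   larger set avoiding it, so J := {j | j leads I \ {j}} is well-ordered by
   j <= k iff j leads I \ {j, k}, and C is the lexicographic rule of this
   order: the leader of the set of voters indifferent between a and b is the
   least non-indifferent member of J. Profiles with at most two
   non-indifferent voters recover (J, <=) from the rule. *)

(** * Preorders, moved alternatives and profiles built by groups of voters *)

Lemma ppo_refl (A : Type) (R : ppo A) a : R a a.
Proof. exact: (Relation_Definitions.preord_refl _ _ (ppo_preorder R)). Qed.

Lemma ppo_trans (A : Type) (R : ppo A) a b c : R a b -> R b c -> R a c.
Proof. exact: (Relation_Definitions.preord_trans _ _ (ppo_preorder R)). Qed.

Lemma ppo_eq (A : Type) (R S : ppo A) : (forall a b, R a b <-> S a b) -> R = S.
Proof.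
case: R S => [R hR] [S hS] /= RS.
have {RS}E : R = S by apply/funext => a; apply/funext => b; exact/propext.
by case: _ / E hS => hS; rewrite (Prop_irrelevance hR hS).
Qed.

Lemma indiff_sym (A : Type) (R : ppo A) a b : indiff R a b -> indiff R b a.
Proof. by case. Qed.

Definition full (A : Type) : ppo A.
Proof. by exists (fun _ _ => True). Defined.
Arguments full {A}.

Inductive place := Top | Bottom | Apart.

Definition insert_rel (A : Type) (p : place) (z : A) (R : A -> A -> Prop)
    (x y : A) : Prop :=
  (x = z /\ (y = z \/ p = Top)) \/ (y = z /\ p = Bottom) \/
  (x <> z /\ y <> z /\ R x y).

Lemma insert_preorder (A : Type) (p : place) (z : A) (R : ppo A) :
  Relation_Definitions.preorder A (insert_rel p z R).
Proof.
split=> [x|x y t]; rewrite /insert_rel.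
  have [->|xz] := pselect (x = z); first by left; split=> //; left.
  by right; right; split=> //; split=> //; exact: ppo_refl.
have := @ppo_trans _ R x y t.
by have [] := pselect (x = z); have [] := pselect (t = z); intuition congruence.
Qed.

(* [insert p z R] moves [z] strictly above, strictly below, or out of
   comparison with all other alternatives, keeping [R] among the latter. *)
Definition insert (A : Type) (p : place) (z : A) (R : ppo A) : ppo A :=
  PPO (insert_preorder p z R).

(** For [a <> c], a complete preorder with every third alternative strictly between [a] and [c]: it
    serves as a strict ranking of three alternatives. *)
Definition chain (A : Type) (a c : A) : ppo A := insert Top a (insert Bottom c full).

Ltac order := rewrite /chain /strict /indiff /insert /= /insert_rel /=;
  intuition congruence.

Lemma insert_lpo (A : Type) (p : place) (z : A) (R : ppo A) : p <> Apart ->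
  lpo A R -> lpo A (insert p z R).
Proof.
move=> pA lR a b; have := lR a b; rewrite /insert /= /insert_rel.
have [] := pselect (a = z); have [] := pselect (b = z); case: p pA => // _.
all: by intuition.
Qed.

Lemma chain_lpo (A : Type) (a c : A) : lpo A (chain a c).
Proof. by do 2!apply: insert_lpo => //; left. Qed.

(** [N] takes precedence over [L], and nesting in [Q] adds further groups. Giving [N] the value
    [full] makes it indifferent on all pairs at once. *)
Definition staged (I A : Type) (N L : set I) (R : ppo A) (Q : profile I A) :
    profile I A :=
  fun i => if `[<N i>] then full else if `[<L i>] then R else Q i.

Lemma stagedP (I A : Type) (N L : set I) R Q (i : I) (Phi : ppo A -> Prop) :
  (N i -> Phi full) -> (~ N i -> L i -> Phi R) ->
  (~ N i -> ~ L i -> Phi (Q i)) -> Phi (@staged I A N L R Q i).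
Proof. by rewrite /staged; case: asboolP => Ni; [|case: asboolP => Li]; auto. Qed.

Ltac stage :=
  repeat match goal with
  | Q := staged _ _ _ _ |- context [?Q' ?i] => constr_eq Q Q'; unfold Q
  end;
  match goal with
  | |- context [staged ?N ?L ?R ?Q ?i] =>
      pattern (staged N L R Q i); refine (@stagedP _ _ N L R Q i _ _ _ _)
  end; cbv beta.

Lemma staged_indiff (I A : Type) (N L : set I) R Q (a b : A) i :
  N i -> indiff (staged N L R Q i) a b.
Proof. by move=> Ni; rewrite /staged asboolT. Qed.

Lemma staged_at (I A : Type) (N L : set I) (R : ppo A) Q i :
  ~ N i -> L i -> staged N L R Q i = R.
Proof. by move=> Ni Li; rewrite /staged asboolF // asboolT. Qed.

(** * Propagation between pairs of alternatives *)

Section ThreeAlternatives.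
Variable A : Type.
Hypothesis three : exists a b c : A, [/\ a <> b, b <> c & a <> c].

Lemma third (a b : A) : exists c, c <> a /\ c <> b.
Proof.
have [x [y [z [xy yz xz]]]] := three.
have [xa|xa] := pselect (x = a); have [xb|xb] := pselect (x = b).
- by exists y; split; congruence.
- by have [yb|yb] := pselect (y = b); [exists z|exists y]; split; congruence.
- by have [ya|ya] := pselect (y = a); [exists z|exists y]; split; congruence.
- by exists x.
Qed.

(** Replacing one endpoint at a time leads from one pair of distinct alternatives to any other. *)
Lemma spread_distinct (D : A -> A -> Prop) :
  (forall x y z, x <> y -> z <> x -> z <> y -> D x y -> D x z /\ D z y) ->
  forall a b, a <> b -> D a b -> forall x y, x <> y -> D x y.
Proof.
move=> step a b ab Dab x y xy.
have fromx x' y' z : x' <> y' -> z <> x' -> D x' y' -> D x' z.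
  move=> n1 n2 d; have [->//|n3] := pselect (z = y').
  by have [] := step x' y' z n1 n2 n3 d.
have tox x' y' z : x' <> y' -> z <> y' -> D x' y' -> D z y'.
  move=> n1 n2 d; have [->//|n3] := pselect (z = x').
  by have [] := step x' y' z n1 n3 n2 d.
(* If [x = b], the direct route would pass through the degenerate pair [(b, b)]; the detour is
   [(a, b)], [(a, c)], [(x, c)], [(x, y)]. *)
have [xb|xb] := pselect (x = b).
  have [c [ca cb]] := third a b.
  have Dac : D a c by apply: (fromx a b).
  have Dxc : D x c by apply: (tox a c) => //; congruence.
  by apply: (fromx x c) => //; congruence.
have Dxb : D x b by apply: (tox a b).
by apply: (fromx x b) => //; congruence.
Qed.

(** * Field expansion and splitting of decisive sets *)

Section Arrow.
Variables (I : Type) (C : voting_system I A).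
Hypotheses (C_unanimous : unanimity C) (C_iia : iia C) (C_lpo : preserves_lpo C).
Implicit Types (P : profile I A) (N L : set I).

Lemma iia_agree P P' a b :
  (forall i, (P i a b <-> P' i a b) /\ (P i b a <-> P' i b a)) ->
  C P a b -> C P' a b.
Proof.
move=> E; suff [] : C P a b <-> C P' a b by [].
by apply: C_iia; apply/funext => i; apply/propext; case: (E i).
Qed.

Definition pair_decisive N L a b := forall P,
  (forall i, N i -> indiff (P i) a b) ->
  (forall i, L i -> strict (P i) a b) -> C P a b.

(* Decisive only against unanimous opposition of the remaining voters. *)
Definition pair_semidecisive N L a b := forall P,
  (forall i, N i -> indiff (P i) a b) ->
  (forall i, L i -> strict (P i) a b) ->
  (forall i, ~ N i -> ~ L i -> strict (P i) b a) -> C P a b.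

(** A single witness suffices: the three conditions fix every voter's comparison of [a] and [b], so
    IIA carries the outcome to all such profiles. *)
Lemma semidecisive_profile N L a b P : C P a b ->
  (forall i, N i -> indiff (P i) a b) ->
  (forall i, L i -> strict (P i) a b) ->
  (forall i, ~ N i -> ~ L i -> strict (P i) b a) -> pair_semidecisive N L a b.
Proof.
move=> Cab PN PL PO Q QN QL QO; apply: iia_agree Cab => i.
move: (PN i) (PL i) (PO i) (QN i) (QL i) (QO i); rewrite /strict /indiff.
by have [] := pselect (N i); have [] := pselect (L i); intuition.
Qed.

(** Let [L] rank [a], [b], [c] in this order and the remaining voters lift [b] to the top. Then [a]
    beats [b] by semidecisiveness and [b] beats [c] by unanimity, while the comparison of [a] and
    [c] is still that of [P]. The second half is the mirror image. *)
Lemma semidecisive_step N L a b c : L `<=` ~` N ->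
  a <> b -> c <> a -> c <> b -> pair_semidecisive N L a b ->
  pair_decisive N L a c /\ pair_decisive N L c b.
Proof.
move=> LN ab ca cb sab; split=> P PN PL.
  pose Q := staged N L (chain a c) (fun i => insert Top b (P i)).
  have Qab : C Q a b.
    apply: sab => i; first exact: staged_indiff.
      by move=> Li; rewrite /Q staged_at //; [order|exact: LN].
    by move=> Ni Li; rewrite /Q; stage => // _ _; order.
  have Qbc : C Q b c by apply: C_unanimous => i; stage => // _ _; order.
  apply: iia_agree (ppo_trans Qab Qbc) => i; move: (PN i) (PL i).
  by stage; order.
pose Q := staged N L (chain c b) (fun i => insert Bottom a (P i)).
have Qab : C Q a b.
  apply: sab => i; first exact: staged_indiff.
    by move=> Li; rewrite /Q staged_at //; [order|exact: LN].
  by move=> Ni Li; rewrite /Q; stage => // _ _; order.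
have Qca : C Q c a by apply: C_unanimous => i; stage => // _ _; order.
apply: iia_agree (ppo_trans Qca Qab) => i; move: (PN i) (PL i).
by stage; order.
Qed.

(** The first step upgrades semidecisiveness to decisiveness on one pair; further steps spread it to
    all pairs. *)
Lemma semidecisive_decisive N L a b : L `<=` ~` N ->
  a <> b -> pair_semidecisive N L a b -> decisive C N L.
Proof.
move=> LN ab sab; split=> // P x y; move: P.
have [-> P _ _|xy] := pselect (x = y); first exact: ppo_refl.
have [c [ca cb]] := third a b.
have [dac _] := semidecisive_step LN ab ca cb sab.
apply: (spread_distinct _ (nesym ca) dac xy) => x' y' z xy' zx zy d.
by apply: semidecisive_step => // P PN PL _; apply: d.
Qed.

(* On the Condorcet profile, completeness of the outcome hands the decision
   of [L1 `|` L2] to one of the two parts. *)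
Lemma decisive_split N L1 L2 : L1 `&` L2 = set0 ->
  decisive C N (L1 `|` L2) -> decisive C N L1 \/ decisive C N L2.
Proof.
move=> L12 [LN dL].
have disj i : L1 i -> L2 i -> False by move=> i1 i2; rewrite -[False]/(set0 i) -L12.
have L1N i : L1 i -> ~ N i by move=> Li; apply: LN; left.
have L2N i : L2 i -> ~ N i by move=> Li; apply: LN; right.
have [a [b [c [ab bc ac]]]] := three.
(* [L1] ranks [a], [b], [c]; [L2] ranks [b], [c], [a]; the rest rank [c], [a], [b]. Only [L1] puts
   [a] above [c], and only [L2] puts [b] above [a]. *)
pose Q := staged N L1 (chain a c) (staged N L2 (chain b a) (fun=> chain c b)).
have Qbc : C Q b c.
  apply: dL => i; first exact: staged_indiff.
  rewrite -[(_ `|` _) i]/(L1 i \/ L2 i); move: (L1N i) (L2N i).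
  by stage; [order|order|move=> ? ?; stage; order].
have [Qab|Qba] : C Q a b \/ C Q b a.
  apply: C_lpo => i; stage => [_||_ _]; [by left| |].
    by move=> _ _; exact: chain_lpo.
  by stage => [_||_ _]; [by left|move=> _ _|]; exact: chain_lpo.
- left; apply: (@semidecisive_decisive N L1 a c) => //.
  apply: semidecisive_profile (ppo_trans Qab Qbc) _ _ _ => i.
  + exact: staged_indiff.
  + by move: (L1N i); stage; order.
  + by move=> Ni Li; do 2!(stage => // ? ?); order.
- right; apply: (@semidecisive_decisive N L2 b a) => //; first exact: nesym.
  apply: semidecisive_profile Qba _ _ _ => i.
  + by move=> Ni; apply: indiff_sym; exact: staged_indiff.
  + move: (L2N i) (disj i).
    by stage; [order|order|move=> ? ?; stage; order].
  + by move=> Ni Li; stage => // ? ?; [order|stage => // ? ?; order].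
Qed.

(** * A decisive singleton dictates *)

Section Dictator.
Variables (N : set I) (j : I).
Hypotheses (dj : decisive C N [set j]) (d0 : ~ decisive C N set0).

Let Nj : ~ N j. Proof. by case: dj => + _; apply. Qed.

Let decides P a b :
  (forall i, N i -> indiff (P i) a b) -> strict (P j) a b -> C P a b.
Proof. by case: dj => _ d PN Pj; apply: d => // i ->. Qed.

(** Otherwise let [j] rank [a], [c], [b] and the other voters outside [N] put [c] on top. Then [b]
    beats [a] and [a] beats [c], so [b] beats [c] against everyone outside [N], which makes the
    empty set decisive. *)
Lemma dictator_strict P a b :
  (forall i, N i -> indiff (P i) a b) -> strict (P j) a b -> ~ C P b a.
Proof.
move=> PN Pj Pba; have ab : a <> b by case: Pj => + + ab; rewrite ab.
have [c [ca cb]] := third a b.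
pose Q := staged N [set j] (chain a b) (fun i => insert Top c (P i)).
have Qj : Q j = chain a b by exact: staged_at.
have Qba : C Q b a.
  apply: iia_agree Pba => i; move: (PN i).
  stage => [||_ _]; [order| |order].
  by move=> _ ->; move: Pj; order.
have Qac : C Q a c.
  by apply: decides => [i|]; [exact: staged_indiff|rewrite Qj; order].
apply: d0; apply: (@semidecisive_decisive N set0 b c) => //; first exact: nesym.
apply: semidecisive_profile (ppo_trans Qba Qac) _ _ _ => // i.
  exact: staged_indiff.
by move=> Ni _; stage => // _ _; order.
Qed.

(* If j finds a and b incomparable but C ranks a above b, field expansion makes
   C rank x above y, for all x and y, whenever j finds them incomparable. With c
   incomparable at j to both a and b, this makes C rank b above c above a even
   though j strictly prefers a to b. *)
Lemma dictator_apart P a b : (forall i, N i -> indiff (P i) a b) ->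
  ~ P j a b -> ~ P j b a -> ~ C P a b.
Proof.
move=> PN nab nba Pab.
have ab : a <> b by move=> E; apply: nab; rewrite E; exact: ppo_refl.
have [c [ca cb]] := third a b.
pose S x y := forall Q, (forall i, N i -> indiff (Q i) x y) ->
  ~ Q j x y -> ~ Q j y x -> C Q x y.
(* On [a] and [c] this profile does not depend on [P]: [N] ties them, [j] finds them incomparable,
   the rest prefer [c]. So the outcome [a] over [c] transfers to [Q1] for an arbitrary [Q]. *)
pose P1 := staged N [set j] (insert Apart a (chain b c))
  (fun i => insert Top c (P i)).
have P1ac : C P1 a c.
  have P1ab : C P1 a b.
    apply: iia_agree Pab => i; move: (PN i).
    stage => [||_ _]; [order| |order].
    by move=> _ ->; order.
  apply: ppo_trans P1ab _; apply: decides => [i|]; first exact: staged_indiff.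
  by rewrite /P1 staged_at //; order.
have Sab : S a b.
  move=> Q QN Qab Qba.
  pose Q1 := staged N [set j] (insert Apart a (chain c b))
    (fun i => insert Top c (Q i)).
  have Q1ac : C Q1 a c.
    apply: iia_agree P1ac => i; rewrite /P1 /Q1 /staged.
    by case: asboolP => Ni //; case: asboolP => ij //; order.
  have Q1cb : C Q1 c b.
    by apply: decides => [i|]; [exact: staged_indiff|rewrite /Q1 staged_at //; order].
  apply: iia_agree (ppo_trans Q1ac Q1cb) => i; move: (QN i).
  by stage => [||_ _]; [order|move=> _ ->; order|order].
have Sall : forall x y, x <> y -> S x y.
  (* A strict preference of [j], for [y] over [z] or for [z] over [x], prolongs [x] over [y] by
     transitivity. *)
  apply: (spread_distinct _ ab Sab) => x y z xy zx zy Sxy; split=> Q QN Qn1 Qn2.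
    pose Q1 := staged N [set j] (insert Apart x (chain y z))
      (fun i => insert Top y (Q i)).
    have Q1j : Q1 j = insert Apart x (chain y z) by exact: staged_at.
    have Q1xy : C Q1 x y.
      by apply: Sxy => [i||]; [exact: staged_indiff|rewrite Q1j; order..].
    have Q1yz : C Q1 y z.
      by apply: decides => [i|]; [exact: staged_indiff|rewrite Q1j; order].
    apply: iia_agree (ppo_trans Q1xy Q1yz) => i; move: (QN i).
    by stage => [||_ _]; [order|move=> _ ->; order|order].
  pose Q1 := staged N [set j] (insert Apart y (chain z x))
    (fun i => insert Top x (Q i)).
  have Q1j : Q1 j = insert Apart y (chain z x) by exact: staged_at.
  have Q1xy : C Q1 x y.
    by apply: Sxy => [i||]; [exact: staged_indiff|rewrite Q1j; order..].
  have Q1zx : C Q1 z x.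
    by apply: decides => [i|]; [exact: staged_indiff|rewrite Q1j; order].
  apply: iia_agree (ppo_trans Q1zx Q1xy) => i; move: (QN i).
  by stage => [||_ _]; [order|move=> _ ->; order|order].
pose Q := staged N [set j] (insert Apart c (chain a b)) (fun=> full).
have Qj : Q j = insert Apart c (chain a b) by exact: staged_at.
have Qi x y i : N i -> indiff (Q i) x y by exact: staged_indiff.
have Qbc : C Q b c.
  by apply: Sall => [|i||]; [exact: nesym|exact: Qi|rewrite Qj; order..].
have Qca : C Q c a by apply: Sall => // [i||]; [exact: Qi|rewrite Qj; order..].
by apply: (@dictator_strict Q a b) (ppo_trans Qbc Qca) => [i|];
  [exact: Qi|rewrite Qj; order].
Qed.

End Dictator.

(** * Leaders and their well-ordering *)

Definition leads N j := ~ N j /\ forall P a b,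
  (forall i, N i -> indiff (P i) a b) -> ~ indiff (P j) a b ->
  (C P a b <-> P j a b).

(** A nonempty minimal decisive set [L] splits into [{j}] and the rest; minimality rules out the
    rest, so [{j}] is decisive. *)
Lemma decisive_or_leads N : principal C ->
  decisive C N set0 \/ exists j, leads N j.
Proof.
move=> /(_ N) [L [dL minL]].
have [|d0] := pselect (decisive C N set0); [by left|right].
have [j Lj] : L !=set0.
  by apply: contrapT => /set0P/negP; rewrite negbK => /eqP L0; rewrite L0 in dL.
exists j.
have [dj|dLj] : decisive C N [set j] \/ decisive C N (L `\ j).
  apply: decisive_split; first by apply/seteqP; split=> // i [->] [_ /(_ erefl)].
  by rewrite setD1K.
- split=> [|P a b PN Pj]; first by case: dj => + _; apply.
  split=> [Pab|jab].
    apply: contrapT => nab; have [ba|nba] := pselect (P j b a).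
      apply: (dictator_strict dj d0 _ _ Pab) => // i /PN; exact: indiff_sym.
    exact: (dictator_apart dj d0 PN nab nba).
  by case: dj => _ d; apply: d => // i ->; split=> // ba; apply: Pj.
- have E : L `\ j = L by apply: minL => // i [].
  by move: Lj; rewrite -E => -[_ /(_ erefl)].
Qed.

Lemma leadsW N N' j : N `<=` N' -> ~ N' j -> leads N j -> leads N' j.
Proof. by move=> NN' N'j [_ lj]; split=> // P a b PN; apply: lj => i /NN'/PN. Qed.

(** A decisive empty set would make [C] tie whatever [N] ties, but a strict preference of [j] breaks
    the tie. *)
Lemma leads_nondecisive N j : leads N j -> ~ decisive C N set0.
Proof.
move=> [Nj lj] [_ d0]; have [a [b [_ [ab _ _]]]] := three.
pose P := staged N [set j] (insert Top a full) (fun=> full).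
have Pj : P j = insert Top a full by exact: staged_at.
have PN i : N i -> indiff (P i) b a by exact: staged_indiff.
have Pba : C P b a by apply: d0.
by move: Pba; rewrite (lj P b a PN) Pj; order.
Qed.

(** Two distinct leaders with opposite strict preferences would dictate contradictory outcomes. *)
Lemma leads_unique N j k : leads N j -> leads N k -> j = k.
Proof.
move=> [Nj lj] [Nk lk]; apply: contrapT => jk.
have [a [b [_ [ab _ _]]]] := three.
pose P := staged N [set j] (insert Top a full)
  (staged N [set k] (insert Top b full) (fun=> full)).
have PN i : N i -> indiff (P i) a b by exact: staged_indiff.
have Pj : P j = insert Top a full by exact: staged_at.
have Pk : P k = insert Top b full.
  by stage => // [_ /esym//|_ _]; exact: staged_at.
have Pab : C P a b by rewrite (lj P a b PN) Pj; order.
by move: Pab; rewrite (lk P a b PN) Pk; order.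
Qed.

Definition leaders : set I := [set j | leads (~` [set j]) j].

Definition leader_le j k := [/\ leaders j, leaders k & leads (~` [set j; k]) j].

Lemma leader_least K m : leads (~` K) m ->
  [/\ K m, leaders m & forall i, K i -> leads (~` [set m; i]) m].
Proof.
move=> lm; have Km : K m by case: (lm) => /contrapT.
split=> // [|i Ki]; apply: leadsW lm.
- by move=> i' Ki' E; apply: Ki'; rewrite E.
- by apply.
- by move=> i' Ki' [] E; apply: Ki'; rewrite E.
- by apply; left.
Qed.

Hypothesis C_principal : principal C.

(** If the empty set were decisive relative to the complement of [K], it would be so relative to the
    larger complement of [{k}], which [k] leads. *)
Lemma leads_of_leader K k : leaders k -> K k -> exists m, leads (~` K) m.
Proof.
move=> lk Kk; case: (decisive_or_leads (~` K) C_principal) => // -[_ d0].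
case: (leads_nondecisive lk); split=> // P a b PN _; apply: d0 => // i Ki.
by apply: PN => ik; apply: Ki; rewrite ik.
Qed.

(** The leader of the complement of [B] is the least element of [B]. Sets of two and three leaders
    then give totality and transitivity. *)
Lemma leader_le_least B : B `<=` leaders -> B !=set0 ->
  exists m, least_in leader_le B m.
Proof.
move=> BJ [k Bk]; have [m lm] := leads_of_leader (BJ k Bk) Bk.
have [Bm Jm lem] := leader_least lm; exists m; split=> // i Bi.
by split=> //; [exact: BJ|exact: lem].
Qed.

Lemma leader_le_total : total_on leaders leader_le.
Proof.
move=> j k Jj Jk; have [||m [[->|->] lem]] := @leader_le_least [set j; k].
- by move=> i [] ->.
- by exists j; left.
- by left; apply: lem; right.
- by right; apply: lem; left.
Qed.

Lemma leader_le_refl j : leaders j -> leader_le j j.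
Proof. by move=> Jj; split=> //; rewrite setUid. Qed.

Lemma leader_le_anti j k : leader_le j k -> leader_le k j -> j = k.
Proof. by move=> [_ _ ljk] [_ _]; rewrite setUC; exact: leads_unique. Qed.

Lemma leader_le_trans i j k : leader_le i j -> leader_le j k -> leader_le i k.
Proof.
move=> ij jk; have [[Ji Jj _] [_ Jk _]] := (ij, jk).
have [||m [mB lem]] := @leader_le_least [set t | [\/ t = i, t = j | t = k]].
- by move=> t [] ->.
- by exists i; constructor.
have [mi mj mk] : [/\ leader_le m i, leader_le m j & leader_le m k].
  by split; apply: lem; [apply: Or31|apply: Or32|apply: Or33].
(* If the least element is [j] or [k], antisymmetry identifies it with [i] or [j] respectively. *)
case: mB => E; rewrite E in mi mj mk => //.
- by rewrite (leader_le_anti ij mi).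
- by rewrite -(leader_le_anti jk mj).
Qed.

Definition leader_order : well_ordering leaders := WellOrdering
  (fun i j h => let: And3 Ji Jj _ := h in conj Ji Jj)
  leader_le_refl leader_le_anti leader_le_trans leader_le_total leader_le_least.

Lemma voting_system_lex : C = lex A leader_order.
Proof.
apply/funext => P; apply: ppo_eq => a b.
pose K := [set i | ~ indiff (P i) a b].
have KN i : (~` K) i -> indiff (P i) a b by move/contrapT.
have [[k [Jk Kk]]|noK] := pselect (exists k, leaders k /\ K k).
  have [m lm] := leads_of_leader Jk Kk; have [Km Jm lem] := leader_least lm.
  have mleast : least_in leader_order [set i | leaders i /\ ~ indiff (P i) a b] m.
    by split=> // i [Ji Ki]; split=> //; exact: lem.
  have [_ /(_ P a b KN Km) ->] := lm; split=> [mab|].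
    by right; exists m.
  case=> [/(_ m Jm)//|[j [jleast jab]]].
  suff -> : m = j by [].
  by apply: leader_le_anti; [exact: mleast.2 _ jleast.1|exact: jleast.2 _ mleast.1].
(* Both sides hold: without a leader in [K] nobody leads its complement, so the empty set is
   decisive relative to it. *)
split=> [_|_].
  by left=> i Ji; apply: contrapT => Ki; apply: noK; exists i.
case: (decisive_or_leads (~` K) C_principal) => [[_ d0]|[m /leader_least[Km Jm _]]].
  by apply: d0.
by case: noK; exists m.
Qed.

End Arrow.

(** * Lexicographic rules satisfy the axioms *)

Section LexProperties.
Variable I : Type.

Lemma lex_rel_least (J : set I) (le : well_ordering J) (P : profile I A) a b m :
  least_in le [set i | J i /\ ~ indiff (P i) a b] m ->
  (lex_rel le P a b <-> P m a b).
Proof.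
move=> [[Jm mab] leastm]; split=> [|Pm]; last by right; exists m.
apply: lex_rel_at => // i Ji nmi; apply: contrapT => nab.
by apply: nmi; apply: leastm.
Qed.

Lemma lex_cases (J : set I) (le : well_ordering J) (P : profile I A) a b :
  (forall i, J i -> indiff (P i) a b) \/
  exists m, least_in le [set i | J i /\ ~ indiff (P i) a b] m.
Proof.
have [|/existsNP[i /not_implyP[Ji nab]]] :=
  pselect (forall i, J i -> indiff (P i) a b); [by left|right].
by apply: wo_least; [move=> ? []|exists i].
Qed.

Lemma lex_unanimous (J : set I) (le : well_ordering J) : unanimity (lex A le).
Proof.
move=> P a b Pab; have [Jab|[m leastm]] := lex_cases le P a b; first by left.
by apply/(lex_rel_least leastm).
Qed.

Lemma lex_iia (J : set I) (le : well_ordering J) : iia (lex A le).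
Proof.
suff imp (P P' : profile I A) a b : (forall i, P i a b = P' i a b) ->
    (forall i, P i b a = P' i b a) -> lex A le P a b -> lex A le P' a b.
  move=> P P' a b ab ba.
  have {}ab i : P i a b = P' i a b := congr1 (@^~ i) ab.
  have {}ba i : P i b a = P' i b a := congr1 (@^~ i) ba.
  by split; apply: imp => // i; rewrite ?ab ?ba.
move=> ab ba.
have E i : indiff (P i) a b = indiff (P' i) a b by rewrite /indiff ab ba.
have [Jab|[m leastm]] := lex_cases le P a b.
  by move=> _; left=> i Ji; rewrite -E; exact: Jab.
move=> /(lex_rel_least leastm) Pm; right; exists m; rewrite -ab; split=> //.
have -> // : [set i | J i /\ ~ indiff (P' i) a b] =
  [set i | J i /\ ~ indiff (P i) a b].
by apply/funext => i /=; rewrite E.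
Qed.

Lemma lex_preserves_lpo (J : set I) (le : well_ordering J) :
  preserves_lpo (lex A le).
Proof.
move=> P lP a b; have [Jab|[m leastm]] := lex_cases le P a b; first by left; left.
have [Pab|Pba] := lP m a b; first by left; apply/(lex_rel_least leastm).
right; right; exists m; split=> //; case: leastm => -[Jm nab] leastm.
split=> [|i [Ji nba]]; first by split=> // h; apply: nab; exact: indiff_sym.
by apply: leastm; split=> // h; apply: nba; exact: indiff_sym.
Qed.

(** The minimal decisive set is empty if [N] contains [J], and otherwise consists of the least
    element [m] of [J] outside [N]. *)
Lemma lex_principal (J : set I) (le : well_ordering J) : principal (lex A le).
Proof.
move=> N; have [JN|/existsNP[i /not_implyP[Ji Ni]]] := pselect (J `<=` N).
  exists set0; split=> [|L]; last by rewrite subset0.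
  by split=> // P a b PN _; left=> i /JN/PN.
have [m [[Jm Nm] leastm]] : exists m, least_in le (J `&` ~` N) m.
  by apply: wo_least; [move=> ? []|exists i].
have least_at (P : profile I A) a b : (forall i, N i -> indiff (P i) a b) ->
    ~ indiff (P m) a b ->
    least_in le [set i | J i /\ ~ indiff (P i) a b] m.
  move=> PN nab; split=> // k [Jk kab]; apply: leastm; split=> //.
  by move=> /PN.
exists [set m]; split.
  split=> [_ -> //|P a b PN Pm].
  have mab : strict (P m) a b by exact: Pm.
  by apply/(@lex_rel_least _ _ _ _ _ m); [apply: least_at => // -[_ /mab.2]|exact: mab.1].
move=> L Lm [LN dL]; apply/seteqP; split=> // _ ->.
apply: contrapT => nLm; have [a [b [_ [ab _ _]]]] := three.
(* If [L] missed [m] it would be empty, and its decisiveness would rank [b] over [a] although [m]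
   strictly prefers [a]. *)
pose P := staged N [set m] (insert Top a full) (fun=> full).
have Pm : P m = insert Top a full by exact: staged_at.
have PN k : N k -> indiff (P k) b a by exact: staged_indiff.
have Pba : lex A le P b a.
  by apply: dL => // k Lk; case: nLm; rewrite -(Lm k Lk).
have nba : ~ indiff (P m) b a by rewrite Pm; order.
by move: Pba => /(lex_rel_least (least_at _ _ _ PN nba)); rewrite Pm; order.
Qed.

Lemma lex_principal_arrow (J : set I) (le : well_ordering J) :
  principal_arrow (lex A le).
Proof.
split; [exact: lex_principal|exact: lex_unanimous|
  exact: lex_iia|exact: lex_preserves_lpo].
Qed.

(** * Recovering the set and its order from the rule *)

(** The profile detects membership in [J]: only [j] is not indifferent, and a rule ignores [j]
    exactly when [j] lies outside [J]. *)
Lemma lex_sole_voter (a b : A) j (J : set I) (le : well_ordering J) : a <> b ->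
  lex A le (staged set0 [set j] (insert Top a full) (fun=> full)) b a <-> ~ J j.
Proof.
move=> ab; set P := staged _ _ _ _.
have Pj : P j = insert Top a full by exact: staged_at.
have Pk k : k <> j -> indiff (P k) b a by move=> kj; stage.
split=> [Pba Jj|Jj].
  have nba : ~ indiff (P j) b a by rewrite Pj; order.
  have leastj : least_in le [set i | J i /\ ~ indiff (P i) b a] j.
    split=> // i [Ji nib]; suff -> : i = j by exact: wo_refl.
    by apply: contrapT => /Pk.
  by move: Pba => /(lex_rel_least leastj); rewrite Pj; order.
by left=> i Ji; apply: Pk => ij; apply: Jj; rewrite -ij.
Qed.

(** The profile detects the order: [j] and [k] disagree, all others are indifferent, and the earlier
    of the two decides. *)
Lemma lex_two_voters (a b : A) j k (J : set I) (le : well_ordering J) :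
  a <> b -> j <> k -> J j -> J k ->
  lex A le (staged set0 [set j] (insert Top a full)
    (staged set0 [set k] (insert Top b full) (fun=> full))) a b <-> le j k.
Proof.
move=> ab jk Jj Jk; set P := staged _ _ _ _.
have Pj : P j = insert Top a full by exact: staged_at.
have Pk : P k = insert Top b full.
  by stage => // [_ /esym//|_ _]; exact: staged_at.
have Pi i : i <> j -> i <> k -> indiff (P i) a b.
  by move=> ij ik; do 2!(stage => // _ _).
have Kjk i : ~ indiff (P i) a b -> i = j \/ i = k.
  move=> Ki; apply: contrapT => /not_orP[ij ik]; apply: Ki; exact: Pi.
have jab : ~ indiff (P j) a b by rewrite Pj; order.
have kab : ~ indiff (P k) a b by rewrite Pk; order.
split=> [Pab|ljk].
  have [//|lkj] := wo_total le Jj Jk.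
  have leastk : least_in le [set i | J i /\ ~ indiff (P i) a b] k.
    by split=> // i [Ji /Kjk[]->//]; exact: wo_refl.
  by move: Pab => /(lex_rel_least leastk); rewrite Pk; order.
have leastj : least_in le [set i | J i /\ ~ indiff (P i) a b] j.
  by split=> // i [Ji /Kjk[]->//]; exact: wo_refl.
by apply/(lex_rel_least leastj); rewrite Pj; order.
Qed.

Lemma well_ordering_eq (J : set I) (le le' : well_ordering J) :
  (forall i j, le i j <-> le' i j) -> le = le'.
Proof.
case: le le' => [le s1 r1 a1 t1 o1 l1] [le' s2 r2 a2 t2 o2 l2] /= E.
have {}E : le = le' by apply/funext => i; apply/funext => j; exact/propext.
by subst le'; congr WellOrdering; exact: Prop_irrelevance.
Qed.

Lemma lex_inj_order (J : set I) : injective (fun le : well_ordering J => lex A le).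
Proof.
move=> le le' E; have [a [b [_ [ab _ _]]]] := three.
suff imp (l l' : well_ordering J) : lex A l = lex A l' ->
    forall i j, l i j -> l' i j.
  by apply: well_ordering_eq => i j; split; apply: imp.
move=> {}E i j lij; have [Ji Jj] := wo_sub lij.
have [<-|ij] := pselect (i = j); first exact: wo_refl.
by apply/(lex_two_voters _ ab ij Ji Jj); rewrite -E; apply/lex_two_voters.
Qed.

Lemma lex_inj : injective (fun w : wo_subset I => lex A (projT2 w)).
Proof.
move=> [J le] [J' le'] /= E; have [a [b [_ [ab _ _]]]] := three.
have EJ : J = J'.
  apply/funext => j; apply/propext/iff_not2.
  by rewrite -(lex_sole_voter j le ab) -(lex_sole_voter j le' ab) E.
by case: _ / EJ le' E => le' /lex_inj_order ->.
Qed.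

(** A voter outside [J] who alone has a strict preference is ignored. If [J] is everything, the
    first non-indifferent voter shares the unanimous direction and makes it strict. *)
Lemma lex_strong_unanimity (J : set I) (le : well_ordering J) :
  strong_unanimity (lex A le) <-> J = [set: I].
Proof.
split=> [[_ su]|JI].
  have [a [b [_ [ab _ _]]]] := three; apply/seteqP; split=> // j _.
  apply: contrapT => /(lex_sole_voter j le ab); set P := staged _ _ _ _.
  suff [_ //] : strict (lex A le P) a b.
  apply: su => [i|]; first by stage => // _ _; order.
  by exists j; rewrite /P staged_at //; order.
split=> [|P a b Pab [i [_ iba]]]; first exact: lex_unanimous.
split; first exact: lex_unanimous.
have [|[m leastm]] := lex_cases le P b a.
  have Ji : J i by rewrite JI.
  by move=> /(_ i Ji) [].
move=> /(lex_rel_least leastm) mba; case: leastm => -[_ +] _; apply.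
by split.
Qed.

End LexProperties.
End ThreeAlternatives.

Theorem theorem5p8 (A I : Type)
    (hA : exists a b c : A, [/\ a <> b, b <> c & a <> c]) :
  [/\ (forall C : voting_system I A, principal_arrow C ->
         exists! w : wo_subset I, C = lex A (projT2 w)),
      set_bij [set: wo_subset I]
        [set C : voting_system I A | principal_arrow C]
        (fun w => lex A (projT2 w)),
      (forall (C : voting_system I A) (J : set I) (le : well_ordering J),
         principal_arrow C -> C = lex A le ->
         (strong_unanimity C <-> J = [set: I]))
    & set_bij [set: well_ordering [set: I]]
        [set C : voting_system I A | principal_arrow C /\ strong_unanimity C]
        (fun le => lex A le)].
Proof.
have lexE (C : voting_system I A) : principal_arrow C ->
    exists w : wo_subset I, C = lex A (projT2 w).
  move=> [C_principal C_un C_iia C_lpo].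
  exists (existT _ (leaders C) (leader_order hA C_un C_iia C_lpo C_principal)).
  exact: voting_system_lex.
split.
- move=> C /lexE[w Cw]; exists w; split=> // w' Cw'.
  by apply: (lex_inj hA); rewrite -Cw.
- split=> [w _|w w' _ _|C /lexE[w ->]]; last by exists w.
    exact: lex_principal_arrow.
  exact: lex_inj.
- by move=> C J le _ ->; exact: lex_strong_unanimity.
- split=> [le _|le le' _ _|C [/lexE[[J le] ->]]].
  + by split; [exact: lex_principal_arrow|apply/lex_strong_unanimity].
  + exact: lex_inj_order.
  + move=> /(lex_strong_unanimity hA) /= JI.
    (* Transport along [J = [set: I]] turns [le] into a well-ordering of all voters. *)
    by case: _ / (esym JI) le => le; exists le.
Qed.
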